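(* Let $G$ be a bipartite graph with no isolated vertices, with $n$ vertices and maximum degree $\Delta(G)$. Then $\gamma_t(G)=n-\Delta(G)+1$ if and only if $G$ is (isomorphic to) a graph of the form $K_{1,t}\cup rK_2$ for some integers $t\geq 1$ and $r\geq 0$.
   Context: Graphs are finite, simple and undirected. A set $S$ of vertices in a graph $G=(V,E)$ is called a total dominating set if every vertex $v\in V$ (including those in $S$) is adjacent to some element of $S$. The total domination number $\gamma_t(G)$ is the minimum cardinality of a total dominating set of $G$. $K_{1,t}$ is the star with one centre and $t$ leaves, and $K_{1,t}\cup rK_2$ denotes the disjoint union of $K_{1,t}$ with $r$ copies of the complete graph $K_2$. *)

(* Defs.v *)
From mathcomp Require Import all_boot.

Set Implicit Arguments.
Unset Strict Implicit.
Unset Printing Implicit Defensive.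

Record sgraph := SGraph {
  vertex :> finType;
  adj : rel vertex;
  adj_sym : symmetric adj;
  adj_irr : irreflexive adj
}.

Section Invariants.
Variable G : sgraph.

Definition nbhd (v : G) : {set G} := [set u | adj v u].

Definition degree (v : G) : nat := #|nbhd v|.

Definition max_degree : nat := \max_(v : G) degree v.

Definition no_isolated : Prop := forall v : G, 0 < degree v.

(* The two parts are [A] and [~: A]; either may be empty. *)
Definition bipartite : Prop :=
  exists A : {set G}, forall u v : G, adj u v -> (u \in A) != (v \in A).

Definition total_dominating (S : {set G}) : bool :=
  [forall v : G, exists u in S, adj v u].

(* The default value #|G| never lowers the minimum, since #|S| <= #|G| for all
   [S]; it only matters as a junk value when [G] has an isolated vertex, in
   which case no total dominating set exists. *)
Definition total_domination_number : nat :=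
  \big[minn/#|G|]_(S : {set G} | total_dominating S) #|S|.

End Invariants.

Definition isomorphic (G H : sgraph) : Prop :=
  exists2 f : G -> H, bijective f & forall u v : G, adj (f u) (f v) = adj u v.

Section Complete.
Variable n : nat.

Definition complete_adj : rel 'I_n := fun u v => u != v.

Lemma complete_sym : symmetric complete_adj.
Proof. by move=> u v; rewrite /complete_adj eq_sym. Qed.

Lemma complete_irr : irreflexive complete_adj.
Proof. by move=> u; rewrite /complete_adj eqxx. Qed.

Definition complete : sgraph := SGraph complete_sym complete_irr.
End Complete.

Section Star.
Variable t : nat.

(* [None] is the centre, the [Some i] are the [t] leaves. *)
Definition star_adj : rel (option 'I_t) := fun u v => isSome u != isSome v.

Lemma star_sym : symmetric star_adj.
Proof. by move=> u v; rewrite /star_adj eq_sym. Qed.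

Lemma star_irr : irreflexive star_adj.
Proof. by move=> u; rewrite /star_adj eqxx. Qed.

Definition star : sgraph := SGraph star_sym star_irr.
End Star.

Section DisjointUnion.
Variables G H : sgraph.

Definition disj_union_adj : rel (G + H) := fun u v =>
  match u, v with
  | inl x, inl y => adj x y
  | inr x, inr y => adj x y
  | _, _ => false
  end.

Lemma disj_union_sym : symmetric disj_union_adj.
Proof. by move=> [u|u] [v|v] //=; rewrite adj_sym. Qed.

Lemma disj_union_irr : irreflexive disj_union_adj.
Proof. by move=> [u|u] /=; rewrite adj_irr. Qed.

Definition disj_union : sgraph := SGraph disj_union_sym disj_union_irr.
End DisjointUnion.

Section Copies.
Variables (r : nat) (G : sgraph).

Definition copies_adj : rel ('I_r * G) := fun u v =>
  (u.1 == v.1) && adj u.2 v.2.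

Lemma copies_sym : symmetric copies_adj.
Proof. by move=> u v; rewrite /copies_adj eq_sym adj_sym. Qed.

Lemma copies_irr : irreflexive copies_adj.
Proof. by move=> u; rewrite /copies_adj adj_irr andbF. Qed.

Definition copies : sgraph := SGraph copies_sym copies_irr.
End Copies.

(* Main.v *)
Require Import Defs.
From mathcomp Require Import all_boot.
From mathcomp Require Import zify.

(** Let [v] have maximum degree.  Any set [U] that dominates a set [Y] extends
    to a total dominating set by adding one neighbour of each vertex outside
    [Y], so the total domination number is at most [n - |Y| + |U|]
    ([total_domination_greedy]).  With [U = {v}] and [Y = N(v)] this is the
    bound [n - Delta + 1].  When that bound is attained, two distinct vertices
    outside [N(v)] cannot have a common neighbour [b]: otherwise [U = {v, b}]
    would dominate [|N(v)| + 2] vertices and save one more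
    ([extremal_common_nbr]).  If [G] is bipartite, this forces every vertex
    other than [v] to have a single neighbour ([extremal_leaves_off]), and
    such a graph consists of a star centred at [v] and a perfect matching of
    the remaining vertices ([leaves_off_isomorphic]).

    Conversely, if every vertex other than [v] has a single neighbour, then a
    total dominating set misses only neighbours of [v], and not all of these
    ([leaves_off_extremal]).  The extremal graphs are therefore exactly those
    satisfying [leaves_off], a condition that is easily carried across an
    isomorphism. *)

Set Implicit Arguments.
Unset Strict Implicit.
Unset Printing Implicit Defensive.

(** * Upper bounds on the total domination number *)

Section TotalDomination.
Variable G : sgraph.
Implicit Types (u v w x y z : G) (S U Y A : {set G}).

Lemma total_domination_le S :
  total_dominating S -> total_domination_number G <= #|S|.
Proof.
move=> tdS; rewrite /total_domination_number.
have : S \in index_enum {set G} by rewrite mem_index_enum.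
elim: (index_enum _) => //= T s IHs; rewrite inE big_cons.
case/predU1P=> [<- | /IHs le]; first by rewrite tdS geq_minl.
by case: ifP => // _; apply: leq_trans (geq_minr _ _) le.
Qed.

Lemma total_domination_ge k :
    k <= #|G| -> (forall S, total_dominating S -> k <= #|S|) ->
  k <= total_domination_number G.
Proof.
move=> kG kS; rewrite /total_domination_number.
by apply: (big_ind (leq k)) => // x y kx ky; rewrite leq_min kx.
Qed.

Definition some_nbr v : G := odflt v [pick u | adj v u].

Lemma adj_some_nbr : no_isolated G -> forall v, adj v (some_nbr v).
Proof.
move=> hiso v; rewrite /some_nbr; case: pickP => //= no_nbr.
by have /card_gt0P[u] := hiso v; rewrite inE no_nbr.
Qed.

(** The extension of [U] adds at most one vertex for each vertex outside [Y],
    so the bound gains whenever [U] dominates more than [#|U|] vertices. *)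
Lemma total_domination_greedy U Y :
    no_isolated G -> (forall y, y \in Y -> exists2 u, u \in U & adj y u) ->
  total_domination_number G + #|Y| <= #|G| + #|U|.
Proof.
move=> hiso domY; set S := U :|: some_nbr @: ~: Y.
have tdS : total_dominating S.
  apply/forallP => y; apply/exists_inP.
  have [/domY[u Uu yu] | notYy] := boolP (y \in Y).
    by exists u; rewrite // inE Uu.
  exists (some_nbr y); last exact: adj_some_nbr.
  by rewrite inE imset_f ?orbT // inE.
have leS := total_domination_le tdS.
have := cardsU U (some_nbr @: ~: Y); rewrite -/S => cardS.
by have := leq_imset_card some_nbr (~: Y); have := cardsC Y; lia.
Qed.

Lemma degree_le_max v : degree v <= max_degree G.
Proof. exact: leq_bigmax. Qed.

Lemma total_domination_le_max_degree v :
    no_isolated G -> degree v = max_degree G ->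
  total_domination_number G <= #|G| - max_degree G + 1.
Proof.
move=> hiso vmax.
have domN y : y \in nbhd v -> exists2 u, u \in [set v] & adj y u.
  by rewrite inE adj_sym => yv; exists v; rewrite ?inE.
have := total_domination_greedy hiso domN; rewrite cards1.
have := max_card (mem (nbhd v)); rewrite -vmax /degree; lia.
Qed.

Lemma extremal_common_nbr v b y z :
    no_isolated G -> degree v = max_degree G ->
    total_domination_number G = #|G| - max_degree G + 1 ->
  ~~ adj v y -> ~~ adj v z -> adj b y -> adj b z -> y = z.
Proof.
move=> hiso vmax ext nvy nvz yb zb; apply/eqP/negPn/negP => neq_yz.
have dom x : x \in [set y; z] :|: nbhd v ->
    exists2 u, u \in [set v; b] & adj x u.
  rewrite !inE => /orP[/orP[]/eqP-> | vx].
  - by exists b; rewrite ?inE ?eqxx ?orbT // adj_sym.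
  - by exists b; rewrite ?inE ?eqxx ?orbT // adj_sym.
  by exists v; rewrite ?inE ?eqxx // adj_sym.
have := total_domination_greedy hiso dom.
have -> : #|[set y; z] :|: nbhd v| = 2 + max_degree G.
  rewrite cardsU cards2 neq_yz -vmax /degree.
  suff -> : [set y; z] :&: nbhd v = set0 by rewrite cards0 subn0.
  apply/setP => x; rewrite !inE; apply/negP => /andP[/orP[]/eqP-> vx].
    by rewrite vx in nvy.
  by rewrite vx in nvz.
have := cards2 v b; have := max_card (mem (nbhd v)).
move: vmax; rewrite ext /degree; case: (v != b) => /=; lia.
Qed.

(** * Graphs that attain the bound *)

(** The graphs without isolated vertices that satisfy this are the disjoint
    unions of one star centred at [v] with copies of [K_2].  Stated with
    adjacency alone, the condition transfers along isomorphisms without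
    counting neighbours. *)
Definition leaves_off v : Prop :=
  forall x, x != v -> forall y z, adj x y -> adj x z -> y = z.

(** The vertices on the side of [v] are all outside [N(v)], so
    [extremal_common_nbr] applies to pairs of neighbours of a vertex on the
    other side.  A vertex [x != v] on the side of [v] shares no neighbour with
    [v] by that first case, so its neighbours are outside [N(v)] as well. *)
Lemma extremal_leaves_off v A :
    no_isolated G -> (forall x y, adj x y -> (x \in A) != (y \in A)) ->
    v \in A -> degree v = max_degree G ->
    total_domination_number G = #|G| - max_degree G + 1 ->
  leaves_off v.
Proof.
move=> hiso hA vA vmax ext.
have sameside y : y \in A -> ~~ adj v y.
  by move=> yA; apply/negP => /hA; rewrite vA yA.
have farside x : x \notin A -> forall y z, adj x y -> adj x z -> y = z.
  move=> nxA y z xy xz.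
  have yA : y \in A by have := hA _ _ xy; rewrite (negPf nxA); case: (y \in A).
  have zA : z \in A by have := hA _ _ xz; rewrite (negPf nxA); case: (z \in A).
  by apply: (extremal_common_nbr hiso vmax ext _ _ xy xz); apply: sameside.
move=> x neq_xv y z xy xz.
have [xA | /farside] := boolP (x \in A); last by apply.
suff nonnbr w : adj x w -> ~~ adj v w.
  exact: (extremal_common_nbr hiso vmax ext (nonnbr _ xy) (nonnbr _ xz) xy xz).
move=> xw; apply: contra neq_xv => vw; apply/eqP; apply: (farside w).
- by have := hA _ _ xw; rewrite xA; case: (w \in A).
- by rewrite adj_sym.
- by rewrite adj_sym.
Qed.

Lemma leaves_off_max_degree v :
  no_isolated G -> leaves_off v -> degree v = max_degree G.
Proof.
move=> hiso leafG; apply/eqP; rewrite eqn_leq degree_le_max /=.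
apply/bigmax_leqP => x _; have [-> // | neq_xv] := eqVneq x v.
apply: leq_trans (hiso v); apply/card_le1_eqP => y z.
by rewrite !inE => xy xz; apply: leafG neq_xv _ _ xz xy.
Qed.

(** A vertex [x] missed by a total dominating set [S] is the only neighbour of
    no vertex, so the neighbours of [x] do not differ from [v]; and [v] has a
    neighbour in [S].  Hence [S] misses at most [Delta - 1] vertices. *)
Lemma leaves_off_extremal v :
    no_isolated G -> leaves_off v ->
  total_domination_number G = #|G| - max_degree G + 1.
Proof.
move=> hiso leafG; have vmax := leaves_off_max_degree hiso leafG.
have degv := hiso v; have degn : degree v <= #|G| by apply: max_card.
apply/eqP; rewrite eqn_leq (total_domination_le_max_degree hiso vmax) /=.
apply: total_domination_ge => [|S /forallP tdS].
  by rewrite -vmax addn1 ltn_subrL degv (leq_trans degv).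
have nbrS x w : x != v -> adj x w -> w \in S.
  move=> neq_xv xw; have /exists_inP[u Su xu] := tdS x.
  by rewrite (leafG x neq_xv w u).
have /exists_inP[w Sw vw] := tdS v.
have subS : ~: S \subset nbhd v :\ w.
  apply/subsetP => x; rewrite !inE => nSx; apply/andP; split.
    by apply: contraNneq nSx => ->.
  have xy := adj_some_nbr hiso x; have [<- | neq] := eqVneq (some_nbr x) v.
    by rewrite adj_sym.
  by case/negP: nSx; apply: nbrS neq _; rewrite adj_sym.
have := subset_leq_card subS; have := cardsD1 w (nbhd v).
by move: degn; rewrite inE vw -(cardsC S) -vmax /degree /=; lia.
Qed.

Lemma bipartition_containing v :
    bipartite G ->
  exists2 A : {set G}, v \in A & forall x y, adj x y -> (x \in A) != (y \in A).
Proof.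
case=> A hA; have [vA | nvA] := boolP (v \in A); first by exists A.
exists (~: A) => [|x y /hA]; first by rewrite inE.
by rewrite !inE (inj_eq negb_inj).
Qed.

Lemma bipartite_extremalP :
    bipartite G -> no_isolated G ->
  total_domination_number G = #|G| - max_degree G + 1 <->
  exists v, leaves_off v.
Proof.
move=> hbip hiso; split=> [ext | [v]]; last exact: leaves_off_extremal.
have [G0 | Gpos] := posnP #|G|.
  (* With no vertices the empty set is total dominating, whereas the
     right-hand side of [ext] is 1. *)
  have td0 : total_dominating (set0 : {set G}).
    by apply/forallP => v; have := card0_eq G0 v; rewrite inE.
  by have := total_domination_le td0; rewrite ext cards0; lia.
have [v vmax] := eq_bigmax (@degree G) Gpos.
have [A vA hA] := bipartition_containing v hbip.
by exists v; apply: extremal_leaves_off hA vA (esym vmax) ext.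
Qed.

End TotalDomination.

(** * Isomorphism with a star and copies of K2 *)

Lemma isomorphic_sym (G H : sgraph) : isomorphic G H -> isomorphic H G.
Proof.
case=> f [g fK gK] fadj; exists g; first by exists f.
by move=> u v; rewrite -fadj !gK.
Qed.

Lemma isomorphic_leaves_off (G H : sgraph) :
  isomorphic G H -> (exists v : H, leaves_off v) -> exists v : G, leaves_off v.
Proof.
case=> f [g fK gK] fadj [v leafH]; exists (g v) => x neq_xv y z xy xz.
apply: (can_inj fK); apply: (leafH (f x)); rewrite ?fadj //.
by apply: contra neq_xv => /eqP <-; rewrite fK.
Qed.

Lemma star_copies_leaves_off t r :
  exists v : disj_union (star t) (copies r (complete 2)), leaves_off v.
Proof.
exists (inl None) => -[[i|]|[i a]] //= _.
  by move=> [[?|]|?] [[?|]|?].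
move=> [?|[j b]] [?|[k c]] //= /andP[/eqP/= <- ab] /andP[/eqP/= <- ac].
congr (inr (_, _)); apply/val_inj.
move: a b c ab ac => [a a2] [b b2] [c c2] /=.
rewrite /complete_adj -!val_eqE /=; lia.
Qed.

(** Outside the star centred at [v], the edges form a perfect matching, and the
    bipartition picks one end of each of them: [C] collects the ends lying on
    the side of [v], so that the copies of [K_2] are indexed by [C]. *)
Lemma leaves_off_isomorphic (G : sgraph) (v : G) :
    bipartite G -> no_isolated G -> leaves_off v ->
  exists r, isomorphic G (disj_union (star (degree v)) (copies r (complete 2))).
Proof.
move=> hbip hiso leafG; have [A vA hA] := bipartition_containing v hbip.
pose nb := @some_nbr G; have nbP : forall x, adj x (nb x) := adj_some_nbr hiso.
have adjE x y : x != v -> adj x y = (y == nb x).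
  move=> neq_xv; apply/idP/eqP => [xy | ->]; last exact: nbP.
  exact: leafG neq_xv _ _ xy (nbP x).
have same x y : (x \in A) = (y \in A) -> adj x y = false.
  by move=> e; apply/negP => /hA; rewrite e eqxx.
pose C := A :\ v; exists #|C|; apply: isomorphic_sym.
have CA (j : 'I_#|C|) : enum_val j \in A.
  by have := enum_valP j; rewrite !inE => /andP[].
have Cv (j : 'I_#|C|) : enum_val j != v.
  by have := enum_valP j; rewrite !inE => /andP[].
have leafA (i : 'I_(degree v)) : (enum_val i \in A) = false.
  by have := enum_valP i; rewrite inE => /hA; rewrite vA; case: (_ \in A).
have leaf_adj (i : 'I_(degree v)) : adj v (enum_val i).
  by have := enum_valP i; rewrite inE.
have nbA (j : 'I_#|C|) : (nb (enum_val j) \in A) = false.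
  by have := hA _ _ (nbP (enum_val j)); rewrite CA; case: (_ \in A).
have notA_v x : (x \in A) = false -> x != v.
  by move=> xA; apply: contraFneq xA => ->.
have adj_v_nb (j : 'I_#|C|) : adj v (nb (enum_val j)) = false.
  apply: contraNF (Cv j) => vn; apply/eqP.
  by apply: (leafG _ (notA_v _ (nbA j))); rewrite adj_sym.
have adj_C_leaf j i : adj (enum_val (j : 'I_#|C|))
                          (enum_val (i : 'I_(degree v))) = false.
  by rewrite adjE //; apply: contraFF (adj_v_nb j) => /eqP <-.
have nb_inj j k : nb (enum_val (j : 'I_#|C|)) = nb (enum_val k) -> j = k.
  move=> e; apply: enum_val_inj; apply: (leafG _ (notA_v _ (nbA j))).
    by rewrite adj_sym.
  by rewrite e adj_sym.
(* [ord0] marks the end of a copy of [K_2] on the side of [v], and the other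
   index its unique neighbour. *)
pose F (h : disj_union (star (degree v)) (copies #|C| (complete 2))) : G :=
  match h with
  | inl None => v
  | inl (Some i) => enum_val i
  | inr (j, b) => if b == ord0 then enum_val j else nb (enum_val j)
  end.
have neqA x y : x \in A -> (y \in A) = false -> x <> y.
  by move=> xA yA e; rewrite e yA in xA.
have ord2 (a b : 'I_2) : (a == b) = ((a == ord0) == (b == ord0)).
  by case: a => [[|[|?]] ?]; case: b => [[|[|?]] ?].
exists F; last first.
  case=> [[i|]|[j a]] [[i'|]|[k b]] //=.
  - by rewrite same ?leafA.
  - by rewrite adj_sym leaf_adj.
  - by rewrite adj_sym; case: ifP => _; rewrite ?adj_C_leaf // same ?leafA ?nbA.
  - by rewrite leaf_adj.
  - by rewrite adj_irr.
  - by case: ifP => _; rewrite ?adj_v_nb // same ?CA ?vA.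
  - by case: ifP => _; rewrite ?adj_C_leaf // same ?leafA ?nbA.
  - by rewrite adj_sym; case: ifP => _; rewrite ?adj_v_nb // same ?CA ?vA.
  rewrite /copies_adj /= /complete_adj ord2.
  case: (a == ord0); case: (b == ord0); rewrite ?andbF ?andbT.
  - by rewrite same ?CA.
  - by rewrite adjE //; apply/eqP/eqP => [/nb_inj | ->].
  - by rewrite adj_sym adjE //; apply/eqP/eqP => [/nb_inj | ->].
  - by rewrite same ?nbA.
(* The side of the bipartition separates the images of most pairs of cases; a
   leaf of the star differs from a [nb]-end because only the former is
   adjacent to [v]. *)
have Finj : injective F.
  case=> [[i|]|[j a]] [[i'|]|[k b]] //= e.
  - by rewrite (enum_val_inj e).
  - by case: (neqA v (enum_val i)).
  - move: e; case: ifP => _ e; first by case: (neqA (enum_val k) (enum_val i)).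
    by have := leaf_adj i; rewrite e adj_v_nb.
  - by case: (neqA v (enum_val i')).
  - move: e; case: ifP => _ e; last by case: (neqA v (nb (enum_val k))).
    by have := Cv k; rewrite -e eqxx.
  - move: e; case: ifP => _ e; first by case: (neqA (enum_val j) (enum_val i')).
    by have := leaf_adj i'; rewrite -e adj_v_nb.
  - move: e; case: ifP => _ e; last by case: (neqA v (nb (enum_val j))).
    by have := Cv j; rewrite e eqxx.
  have := ord2 a b; case: ifP e => _; case: ifP => _ e /eqP eab.
  - by rewrite (enum_val_inj e) eab.
  - by case: (neqA (enum_val j) (nb (enum_val k))).
  - by case: (neqA (enum_val k) (nb (enum_val j))).
  - by rewrite (nb_inj _ _ e) eab.
apply: inj_card_bij Finj _.
suff /subset_leq_card : [set: G] \subset F @: setT.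
  by rewrite cardsT => /leq_trans; apply; rewrite -cardsT; apply: leq_imset_card.
apply/subsetP => x _; have [-> | neq_xv] := eqVneq x v.
  by apply/imsetP; exists (inl None).
have [xA | nxA] := boolP (x \in A).
  have Cx : x \in C by rewrite !inE neq_xv.
  by apply/imsetP; exists (inr (enum_rank_in Cx x, ord0)); rewrite //= enum_rankK_in.
have [vx | nvx] := boolP (x \in nbhd v).
  apply/imsetP; exists (inl (Some (enum_rank_in vx x))) => //=.
  by rewrite enum_rankK_in.
have nbv : nb x != v.
  by apply: contra nvx => /eqP <-; rewrite inE adj_sym.
have Cnb : nb x \in C.
  by rewrite !inE nbv /=; have := hA _ _ (nbP x); rewrite (negPf nxA); case: (_ \in A).
apply/imsetP; exists (inr (enum_rank_in Cnb (nb x), ord_max)) => //=.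
by rewrite enum_rankK_in //; apply/eqP; rewrite -adjE // adj_sym.
Qed.

Theorem theorem4 (G : sgraph) (hbip : bipartite G) (hiso : no_isolated G) :
  total_domination_number G = #|G| - max_degree G + 1 <->
  exists t r : nat,
    1 <= t /\ isomorphic G (disj_union (star t) (copies r (complete 2))).
Proof.
rewrite bipartite_extremalP //; split=> [[v leafG] | [t [r [_ iso]]]].
  have [r iso] := leaves_off_isomorphic hbip hiso leafG.
  by exists (degree v), r; split; first exact: hiso.
exact: isomorphic_leaves_off iso (star_copies_leaves_off t r).
Qed.
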